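(* Let $R$ and $S$ be rings, ${}_S M_R$ an $S$-$R$-bimodule, and $\Gamma=\begin{pmatrix} R & 0\\ M & S\end{pmatrix}$. Assume: (3) the functor ${\rm Hom}_S(M,-)$ takes every acyclic complex of injective $S$-modules to an acyclic complex of $R$-modules; and (4) for every injective $S$-module $I$, ${\rm Ext}^1_R({\rm Hom}_S(M,I),H)=0$ for every Gorenstein injective $R$-module $H$. Then a $\Gamma$-module $(X,Y)_\varphi$, with $\varphi:X\to{\rm Hom}_S(M,Y)$, is Gorenstein injective if and only if (a) $Y$ is a Gorenstein injective $S$-module and $\ker\varphi$ is a Gorenstein injective $R$-module, and (b) $\varphi:X\to{\rm Hom}_S(M,Y)$ is an epimorphism.
   Context: All modules are left modules. Left $\Gamma$-modules are identified with triples $(X,Y)_\varphi$ with $X$ a left $R$-module, $Y$ a left $S$-module and $\varphi:X\to{\rm Hom}_S(M,Y)$ an $R$-linear map (equivalently, via adjunction, an $S$-linear map $M\otimes_RX\to Y$). A complex $J$ of injective $A$-modules is totally acyclic if it is exact and ${\rm Hom}_A(E,J)$ is exact for every injective $A$-module $E$; an $A$-module is Gorenstein injective if it is a kernel of some differential of such a complex. *)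

(* Defs.v *)
From HB Require Import structures.
From mathcomp Require Import all_boot all_order all_algebra.
Set Implicit Arguments. Unset Strict Implicit. Unset Printing Implicit Defensive.
Import Order.TTheory GRing.Theory Num.Theory.
Local Open Scope ring_scope.

Section OneRing.
Variable R : nzRingType.

Definition inj_module (E : lmodType R) : Prop :=
  forall (A B : lmodType R) (i : {linear A -> B}), injective i ->
  forall f : {linear A -> E}, exists g : {linear B -> E}, forall a, g (i a) = f a.

Record cpx := Cpx {
  cobj : int -> lmodType R;
  cdif : forall n : int, {linear cobj n -> cobj (n + 1)};
  cdd : forall (n : int) (x : cobj n), cdif (n + 1) (cdif n x) = 0 }.

Definition acyclic (J : cpx) : Prop :=
  forall (n : int) (y : cobj J (n + 1)), cdif J (n + 1) y = 0 ->
    exists x : cobj J n, cdif J n x = y.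

Definition hom_exact (E : lmodType R) (J : cpx) : Prop :=
  forall (n : int) (f : {linear E -> cobj J (n + 1)}),
    (forall e, cdif J (n + 1) (f e) = 0) ->
    exists g : {linear E -> cobj J n}, forall e, cdif J n (g e) = f e.

Definition totally_acyclic (J : cpx) : Prop :=
  [/\ forall n, inj_module (cobj J n), acyclic J &
      forall E : lmodType R, inj_module E -> hom_exact E J].

Definition gor_inj (G : lmodType R) : Prop :=
  exists (J : cpx) (n : int) (iota : {linear G -> cobj J n}),
    [/\ totally_acyclic J, injective iota &
        forall y, cdif J n y = 0 <-> exists g, iota g = y].

(* Ext^1_R(A, H) = 0, via Yoneda extensions: every short exact sequence
   0 -> H -> E -> A -> 0 splits *)
Definition ext1_zero (A H : lmodType R) : Prop :=
  forall (E : lmodType R) (i : {linear H -> E}) (p : {linear E -> A}),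
    injective i -> (forall a, exists e, p e = a) ->
    (forall e, p e = 0 <-> exists h, i h = e) ->
    exists s : {linear A -> E}, forall a, p (s a) = a.
End OneRing.

Record rightAct (R S : nzRingType) (M : lmodType S) := RightAct {
  ract : M -> R -> M;
  ract_addl : forall m m' r, ract (m + m') r = ract m r + ract m' r;
  ract_addr : forall m r r', ract m (r + r') = ract m r + ract m r';
  ract1 : forall m, ract m 1 = m;
  ract_mul : forall m r r', ract (ract m r) r' = ract m (r * r');
  ract_scale : forall s m r, ract (s *: m) r = s *: ract m r }.

Section Triangular.
Variables (R S : nzRingType) (M : lmodType S) (ra : rightAct R M).

(* A presents Hom_S(M, I) as a left R-module ((r f)(m) = f(m r)):
   al is an R-linear bijection from A onto the S-linear maps M -> I. *)
Definition hom_pres (I : lmodType S) (A : lmodType R) (al : A -> M -> I) : Prop :=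
  [/\ forall a s m m', al a (s *: m + m') = s *: al a m + al a m',
      forall r a a' m, al (r *: a + a') m = al a (ract ra m r) + al a' m,
      forall a, (forall m, al a m = 0) -> a = 0 &
      forall h : {linear M -> I}, exists a, forall m, al a m = h m].

(* Hom_S(M, J) is acyclic (exactness only concerns the underlying groups) *)
Definition hom_M_acyclic (J : cpx S) : Prop :=
  forall (n : int) (f : {linear M -> cobj J (n + 1)}),
    (forall m, cdif J (n + 1) (f m) = 0) ->
    exists g : {linear M -> cobj J n}, forall m, cdif J n (g m) = f m.

(* Left Gamma-modules, Gamma = [[R,0],[M,S]], as triples (X,Y)_phi with
   phi : X -> Hom_S(M,Y) R-linear *)
Record gmod := GMod {
  gX : lmodType R;
  gY : lmodType S;
  gphi : gX -> M -> gY;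
  gphi_S : forall x s m m', gphi x (s *: m + m') = s *: gphi x m + gphi x m';
  gphi_R : forall r x x' m, gphi (r *: x + x') m = gphi x (ract ra m r) + gphi x' m }.

Arguments gphi g x m : clear implicits.

Record gmor (A B : gmod) := GMor {
  mX : {linear gX A -> gX B};
  mY : {linear gY A -> gY B};
  mcomm : forall x m, mY (gphi A x m) = gphi B (mX x) m }.

Definition inj_gmod (E : gmod) : Prop :=
  forall (A B : gmod) (i : gmor A B), injective (mX i) -> injective (mY i) ->
  forall f : gmor A E, exists g : gmor B E,
    (forall a, mX g (mX i a) = mX f a) /\ (forall y, mY g (mY i y) = mY f y).

Record gcpx := GCpx {
  gobj : int -> gmod;
  gdif : forall n : int, gmor (gobj n) (gobj (n + 1));
  gddX : forall (n : int) x, mX (gdif (n + 1)) (mX (gdif n) x) = 0;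
  gddY : forall (n : int) y, mY (gdif (n + 1)) (mY (gdif n) y) = 0 }.

Definition gacyclic (J : gcpx) : Prop :=
  forall n : int,
    (forall x, mX (gdif J (n + 1)) x = 0 -> exists x', mX (gdif J n) x' = x) /\
    (forall y, mY (gdif J (n + 1)) y = 0 -> exists y', mY (gdif J n) y' = y).

Definition ghom_exact (E : gmod) (J : gcpx) : Prop :=
  forall (n : int) (f : gmor E (gobj J (n + 1))),
    (forall x, mX (gdif J (n + 1)) (mX f x) = 0) ->
    (forall y, mY (gdif J (n + 1)) (mY f y) = 0) ->
    exists g : gmor E (gobj J n),
      (forall x, mX (gdif J n) (mX g x) = mX f x) /\
      (forall y, mY (gdif J n) (mY g y) = mY f y).

Definition gtotally_acyclic (J : gcpx) : Prop :=
  [/\ forall n, inj_gmod (gobj J n), gacyclic J &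
      forall E, inj_gmod E -> ghom_exact E J].

Definition gor_inj_gmod (G : gmod) : Prop :=
  exists (J : gcpx) (n : int) (iota : gmor G (gobj J n)),
    [/\ gtotally_acyclic J, injective (mX iota), injective (mY iota),
        forall x, mX (gdif J n) x = 0 <-> exists g, mX iota g = x &
        forall y, mY (gdif J n) y = 0 <-> exists g, mY iota g = y].

Definition ker_phi_gor_inj (G : gmod) : Prop :=
  exists (K : lmodType R) (k : {linear K -> gX G}),
    [/\ gor_inj K, injective k &
        forall x, (forall m, gphi G x m = 0) <-> exists z, k z = x].

Definition phi_epi (G : gmod) : Prop :=
  forall h : {linear M -> gY G}, exists x, forall m, gphi G x m = h m.
End Triangular.
Arguments gphi {R S M ra} g x m.

(* Main.v *)
(* An injective Gamma-module is a triple whose Y is injective over S, whose phi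
   is onto and whose ker phi is injective over R; thus X = ker phi + Hom_S(M, Y).

   Let J = (X_n, Y_n) be totally acyclic with kernel G.  The kernels K_n of the
   phi_n form an acyclic complex because Hom_S(M, Y_n) does, by (3); testing J
   on (E, 0) shows that it is totally acyclic.  By (4), Hom_R(Hom_S(M, I), K_n)
   is exact for I injective, so a cycle I -> Y_n lifts to a cycle
   (Hom_S(M, I), I) -> J_n; testing J on that module shows that Y_n is totally
   acyclic.  Surjectivity of phi on G follows from acyclicity of K_n.

   Conversely, from totally acyclic complexes K_n and Y_n for ker phi and Y one
   takes (K_n + Hom_S(M, Y_n), Y_n) with differential
   (k, a) |-> (d k + theta_n a, d a), where d theta_n + theta_(n+1) d = 0.  The
   extension class of X prescribes theta_0 on cycles; theta_n extends to the
   right because K_n is injective, and to the left because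
   Hom_R(Hom_S(M, Y_m), K_n) is exact by (4). *)
Require Import Defs.
From HB Require Import structures.
From mathcomp Require Import all_boot all_order all_algebra.
From mathcomp Require Import boolp.
Set Implicit Arguments. Unset Strict Implicit. Unset Printing Implicit Defensive.
Import GRing.Theory.
Local Open Scope ring_scope.

(** * Linear maps from linear relations, and kernels as modules *)

Section LinearMaps.
Variable R : nzRingType.

Definition mklin (A B : lmodType R) (f : A -> B) (H : linear f) :
  {linear A -> B} := HB.pack f (GRing.isLinear.Build R A B *:%R f H).

Fact zero_linear (A B : lmodType R) : linear (fun _ : A => 0 : B).
Proof. by move=> r u v; rewrite scaler0 addr0. Qed.

(** A total linear relation with trivial fibre over 0 is single-valued, hence the graph of a linear
    map. Maps defined through arbitrary preimages are obtained this way, without quotient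
    modules. *)
Lemma linear_choice (A B : lmodType R) (P : A -> B -> Prop) :
  (forall a, exists b, P a b) -> (forall b, P 0 b -> b = 0) ->
  (forall r a a' b b', P a b -> P a' b' -> P (r *: a + a') (r *: b + b')) ->
  exists f : {linear A -> B}, forall a, P a (f a).
Proof.
move=> /choice[f fP] P0 PL.
have uni a b b' : P a b -> P a b' -> b = b'.
  move=> h h'; apply/esym/eqP; rewrite -subr_eq0; apply/eqP/P0.
  by have := PL (-1) _ _ _ _ h h'; rewrite !scaleN1r addNr addrC.
have fl : linear f by move=> r a a'; apply: uni (fP _) (PL _ _ _ _ _ _ _).
by exists (mklin fl).
Qed.

Section Kernel.
Variables (A B : lmodType R) (f : {linear A -> B}).

Record lker := LKer { lker_elt : A; _ : f lker_elt == 0 }.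

Fact lker_submod_closed : submod_closed (fun x => f x == 0).
Proof.
split=> [|r x y]; rewrite !unfold_in ?linear0 // => /eqP hx /eqP hy.
by rewrite linearP hx hy scaler0 addr0.
Qed.
HB.instance Definition _ := [isSub for lker_elt].
HB.instance Definition _ := [Choice of lker by <:].
HB.instance Definition _ :=
  GRing.SubChoice_isSubLmodule.Build R A _ lker lker_submod_closed.

Definition lker_val : {linear lker -> A} := mklin (linearP (\val : lker -> A)).

Lemma lker_val_inj : injective lker_val.
Proof. exact: val_inj. Qed.

Lemma lkerP x : f x = 0 <-> exists z, lker_val z = x.
Proof.
split=> [/eqP h|[z <-]]; first by exists (LKer h).
by apply/eqP; apply: (valP z).
Qed.

Lemma lker_valE (z : lker) : f (lker_val z) = 0.
Proof. by apply/lkerP; exists z. Qed.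

Section Lift.
Variables (C : lmodType R) (g : {linear C -> A}).
Hypothesis fg0 : forall c, f (g c) = 0.

Fact lker_lift_linear : linear (fun c => LKer (introT eqP (fg0 c))).
Proof. by move=> r c c'; apply: lker_val_inj; rewrite [RHS]linearP /= linearP. Qed.
Definition lker_lift : {linear C -> lker} := mklin lker_lift_linear.

Lemma lker_liftK c : lker_val (lker_lift c) = g c. Proof. by []. Qed.
End Lift.
End Kernel.
End LinearMaps.
Arguments lker_val {R A B f}.
Arguments lker_val_inj {R A B f}.

(** * The R-module Hom_S(M, I) *)

Section LinearMapGroup.
Variables (S : nzRingType) (M : lmodType S).

Record homM (I : lmodType S) := HomM { hfun :> M -> I; hlin : linear hfun }.

Lemma homM_ext (I : lmodType S) (u v : homM I) : (forall m, u m = v m) -> u = v.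
Proof.
case: u v => [u hu] [v hv] /= /funext uv.
by rewrite uv in hu *; rewrite (Prop_irrelevance hu hv).
Qed.

HB.instance Definition _ (I : lmodType S) := gen_eqMixin (homM I).
HB.instance Definition _ (I : lmodType S) := gen_choiceMixin (homM I).

Section Structure.
Variable I : lmodType S.
Implicit Types u v w : homM I.

Fact homM0_linear : linear (fun _ : M => 0 : I).
Proof. by move=> s m m'; rewrite scaler0 addr0. Qed.
Fact homMD_linear u v : linear (fun m => u m + v m).
Proof. by move=> s m m'; rewrite !hlin scalerDr addrACA. Qed.
Fact homMN_linear u : linear (fun m => - u m).
Proof. by move=> s m m'; rewrite hlin opprD scalerN. Qed.

Definition homM0 := HomM homM0_linear.
Definition homMD u v := HomM (homMD_linear u v).
Definition homMN u := HomM (homMN_linear u).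

Fact homMDA : associative homMD.
Proof. by move=> u v w; apply: homM_ext => m /=; rewrite addrA. Qed.
Fact homMDC : commutative homMD.
Proof. by move=> u v; apply: homM_ext => m /=; rewrite addrC. Qed.
Fact homM0D : left_id homM0 homMD.
Proof. by move=> u; apply: homM_ext => m /=; rewrite add0r. Qed.
Fact homMND : left_inverse homM0 homMN homMD.
Proof. by move=> u; apply: homM_ext => m /=; rewrite addNr. Qed.
HB.instance Definition _ :=
  GRing.isZmodule.Build (homM I) homMDA homMDC homM0D homMND.
End Structure.
End LinearMapGroup.

(* The scalar action uses [ra], so it lives on an alias carrying [ra]. *)
Definition Hom (R S : nzRingType) (M : lmodType S) (ra : rightAct R M)
  (I : lmodType S) := homM M I.

Section HomModule.
Variables (R S : nzRingType) (M : lmodType S) (ra : rightAct R M).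
Local Notation Hom := (Hom ra).

HB.instance Definition _ (I : lmodType S) := GRing.Zmodule.on (Hom I).

Section Scaling.
Variable I : lmodType S.

Fact HomZ_linear (r : R) (u : Hom I) : linear (fun m => u (ract ra m r)).
Proof. by move=> s m m'; rewrite ract_addl ract_scale hlin. Qed.
Definition HomZ (r : R) (u : Hom I) : Hom I := HomM (HomZ_linear r u).
Fact HomZA r s (u : Hom I) : HomZ r (HomZ s u) = HomZ (r * s) u.
Proof. by apply: homM_ext => m /=; rewrite ract_mul. Qed.
Fact Hom1Z : left_id 1 HomZ.
Proof. by move=> u; apply: homM_ext => m /=; rewrite ract1. Qed.
Fact HomZDr : right_distributive HomZ +%R.
Proof. by move=> r u v; apply: homM_ext. Qed.
Fact HomZDl u : {morph HomZ^~ u : r s / r + s}.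
Proof.
move=> r s; apply: homM_ext => m /=; rewrite ract_addr.
by have := hlin u 1 (ract ra m r) (ract ra m s); rewrite !scale1r.
Qed.
HB.instance Definition _ :=
  GRing.Zmodule_isLmodule.Build R (Hom I) HomZA Hom1Z HomZDr HomZDl.

Lemma HomPE r (u v : Hom I) m : (r *: u + v) m = u (ract ra m r) + v m.
Proof. by []. Qed.

End Scaling.

Definition lin_of_Hom (I : lmodType S) (u : Hom I) : {linear M -> I} :=
  mklin (hlin u).
Definition Hom_of_lin (I : lmodType S) (u : {linear M -> I}) : Hom I :=
  HomM (linearP u).

Fact Hom_post_subproof (I I' : lmodType S) (f : {linear I -> I'}) (u : Hom I) :
  linear (fun m => f (u m)).
Proof. by move=> s m m'; rewrite hlin linearP. Qed.
Fact Hom_post_linear (I I' : lmodType S) (f : {linear I -> I'}) :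
  linear (fun u => HomM (Hom_post_subproof f u) : Hom I').
Proof. by move=> r u v; apply: homM_ext => m; rewrite HomPE /= linearD. Qed.
Definition Hom_post (I I' : lmodType S) (f : {linear I -> I'}) :
  {linear Hom I -> Hom I'} := mklin (Hom_post_linear f).

Lemma Hom_hom_pres (I : lmodType S) : hom_pres ra (fun u : Hom I => hfun u).
Proof.
split=> [u|r u v m|u u0|h] //=; first exact: hlin.
  exact: homM_ext.
by exists (Hom_of_lin h).
Qed.

End HomModule.

(** * Extension, splitting and lifting of linear maps *)

Section Injectives.
Variable R : nzRingType.

(** The map [g] factors through im f = ker c, and the factored map extends from ker c to [B] because
    [E] is injective. *)
Lemma inj_extend (A B C E : lmodType R) (f : {linear A -> B})
    (c : {linear B -> C}) (g : {linear A -> E}) :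
  inj_module E -> (forall a, c (f a) = 0) ->
  (forall b, c b = 0 -> exists a, f a = b) -> (forall a, f a = 0 -> g a = 0) ->
  exists h : {linear B -> E}, forall a, h (f a) = g a.
Proof.
move=> Einj cf exB fg.
have [g' g'P] : exists g' : {linear lker c -> E},
    forall z, exists2 a, f a = lker_val z & g' z = g a.
  apply: (@linear_choice _ _ _ (fun z e => exists2 a, f a = lker_val z & e = g a)).
  - by move=> z; have [a fa] := exB _ (lker_valE z); exists (g a), a.
  - by move=> _ [a fa ->]; apply: fg; rewrite fa linear0.
  - move=> r z z' _ _ [a fa ->] [a' fa' ->]; exists (r *: a + a').
      by rewrite linearP fa fa' [RHS]linearP.
    by rewrite linearP.
have [h hP] := Einj _ _ _ lker_val_inj g'.
exists h => a; have [z hz] := (lkerP c (f a)).1 (cf a).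
rewrite -hz hP; have [a' fa' ->] := g'P z.
by apply/eqP; rewrite -subr_eq0 -linearB fg // linearB fa' hz subrr.
Qed.

(** The identity of the kernel extends to a retraction [r]; then [a - r a] depends only on [f a],
    which defines the section [s]. *)
Lemma inj_lker_split (A B : lmodType R) (f : {linear A -> B}) :
  inj_module (lker f) -> (forall b, exists a, f a = b) ->
  exists (r : {linear A -> lker f}) (s : {linear B -> A}),
    (forall b, f (s b) = b) /\ (forall a, lker_val (r a) + s (f a) = a).
Proof.
move=> Kinj fsurj.
have [r rP] := Kinj _ _ _ lker_val_inj (mklin (linearP idfun)).
pose P b a' := exists2 a, f a = b & a' = a - lker_val (r a).
have [|a'|t b b' _ _ [a <- ->] [a' <- ->]|s sP] := @linear_choice _ _ _ P.
- by move=> b; have [a <-] := fsurj b; exists (a - lker_val (r a)), a.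
- by case=> a /lkerP[z <-] ->; rewrite rP subrr.
- exists (t *: a + a'); first by rewrite linearP.
  by rewrite [r (_ + _)]linearP [lker_val (_ + _)]linearP opprD addrACA scalerBr.
exists r, s; split=> [b|a].
  by have [a <- ->] := sP b; rewrite linearB lker_valE subr0.
have [a' faa' ->] := sP (f a).
have /lkerP[z az] : f (a - a') = 0 by rewrite linearB faa' subrr.
have : lker_val (r (a - a')) = a - a' by rewrite -az rP.
rewrite [r (_ - _)]linearB [lker_val (_ - _)]linearB => h.
by rewrite addrC -addrA [- _ + _]addrC h addrC subrK.
Qed.

(** Row vectors of length 0 serve as the zero module, notably in the triples (X, 0) and (0, Y). *)
Lemma inj_module0 : inj_module 'rV[R]_0.
Proof.
move=> A B i _ f; exists (mklin (@zero_linear _ B _)) => a.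
by rewrite [RHS]thinmx0 thinmx0.
Qed.

Lemma ext1_lift (A H K C : lmodType R) (i : {linear H -> K})
    (d : {linear K -> C}) (f : {linear A -> C}) :
  ext1_zero A H -> injective i -> (forall k, d k = 0 <-> exists h, i h = k) ->
  (forall a, exists k, d k = f a) ->
  exists g : {linear A -> K}, forall a, d (g a) = f a.
Proof.
(* [E] is the pullback of [d] and [f]; a splitting of [E -> A] lifts [f]. *)
move=> ext i_inj exK liftf.
have el : linear (fun u : K * A => d u.1 - f u.2).
  by move=> r u v; rewrite /= !linearP addrACA -scalerDr.
pose e := mklin el.
have e0 (u : lker e) : d (lker_val u).1 = f (lker_val u).2.
  by apply/eqP; rewrite -subr_eq0; apply/eqP/(lker_valE u).
have jl : linear (fun h => (i h, 0) : K * A).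
  by move=> r h h'; apply: injective_projections; rewrite /= ?linearP ?scaler0 ?addr0.
have ej h : e (mklin jl h) = 0.
  by rewrite /= linear0 subr0; apply/exK; exists h.
pose j := lker_lift ej.
have jP h : lker_val (j h) = (i h, 0) by [].
have pl : linear (fun u : lker e => (lker_val u).2) by move=> r u v; rewrite linearP.
have [|a|u|s sP] := ext _ j (mklin pl).
- by move=> h h' /(congr1 (lker_val (f:=e))); rewrite !jP => -[/i_inj].
- have [k dk] := liftf a.
  have /lkerP[u hu] : e (k, a) = 0 by rewrite /= dk subrr.
  by exists u; apply: (congr1 snd hu).
- split=> [u2|[h <-]]; last exact: (congr1 snd (jP h)).
  have /exK[h ih] : d (lker_val u).1 = 0 by rewrite e0 [_.2]u2 linear0.
  exists h; apply: lker_val_inj; rewrite jP /= ih -[0]u2 /=.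
  by case: (lker_elt u).
have gl : linear (fun a => (lker_val (s a)).1) by move=> r u v; rewrite !linearP.
by exists (mklin gl) => a /=; rewrite e0 -[in RHS](sP a).
Qed.
End Injectives.

(** Starting from [t0], one recursion to the right fills the indices [Posz k] and one to the left
    the indices [Negz k]. Values are transported along equations of integers, since [n + 1] need not
    be convertible to the next constructor form. *)
Lemma int_two_sided_choice (T : int -> Type)
    (P : forall n, T n -> T (n + 1) -> Prop) (t0 : T 0) :
  (forall n (t : T n), exists t', P n t t') ->
  (forall n (t : T (n + 1)), exists t', P n t' t) ->
  exists t : forall n, T n, t 0 = t0 /\ forall n, P n (t n) (t (n + 1)).
Proof.
move=> right left.
pose r n t := sval (cid (right n t)); pose l n t := sval (cid (left n t)).
pose tcast m n (e : m = n) (x : T m) := ecast k (T k) e x.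
have posS k : Posz k + 1 = Posz k.+1 by rewrite -PoszD addn1.
have negS k : Negz k = Negz k.+1 + 1 by rewrite !NegzE -[k.+2]addn1 PoszD opprD addrNK.
have neg0 : 0 = Negz 0 + 1 by [].
pose up := nat_rect (fun k => T (Posz k)) t0 (fun k x => tcast _ _ (posS k) (r _ x)).
pose dn := nat_rect (fun k => T (Negz k)) (l _ (tcast _ _ neg0 t0))
             (fun k x => l _ (tcast _ _ (negS k) x)).
pose t n := match n return T n with Posz k => up k | Negz k => dn k end.
have rightP n m e : t m = tcast (n + 1) m e (r n (t n)) -> P n (t n) (t (n + 1)).
  by case: m / e => /= ->; apply: (svalP (cid (right _ _))).
have leftP n m e : t n = l n (tcast m (n + 1) e (t m)) -> P n (t n) (t (n + 1)).
  by move: e => e; subst m => /= ->; apply: (svalP (cid (left _ _))).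
exists t; split=> // -[k|[|k]].
- exact: (rightP _ _ (posS k)).
- exact: (leftP _ _ neg0).
- exact: (leftP _ _ (negS k)).
Qed.

(** * Complexes, shifts, and exactness of Hom into a complex *)

Section Complexes.
Variable R : nzRingType.
Implicit Types (J : cpx R) (A B E G X : lmodType R).

(** In the complex shifted by [c], a differential must end in index [k + 1 + c], whereas that of [J]
    ends in [k + c + 1]. *)
Definition cdif_cast J m n (e : m + 1 = n) : {linear cobj J m -> cobj J n} :=
  ecast k {linear cobj J m -> cobj J k} e (cdif J m).

(** Shifting the complex puts [G] in degree 0, where the recursion for theta starts. *)
Lemma gor_inj_at0 G : gor_inj G ->
  exists (J : cpx R) (iota : {linear G -> cobj J 0}),
    [/\ totally_acyclic J, injective iota &
        forall y, cdif J 0 y = 0 <-> exists g, iota g = y].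
Proof.
case=> J [n]; have [c ->] : exists c, n = 0 + c by exists n; rewrite add0r.
case=> iota [[Jinj Jac Jhom] iota_inj exJ].
pose d k := cdif_cast J (addrAC k c 1).
have dd k (x : cobj J (k + c)) : d (k + 1) (d k x) = 0.
  (* With the indices generalized, both casts can be eliminated, which leaves a statement about [J]
     itself. *)
  rewrite /d; move: (addrAC k c 1) (addrAC (k + 1) c 1) x.
  move: (k + c) (k + 1 + c) => a b e; case: b / e => e.
  by case: _ / e => x; apply: cdd.
exists (Cpx dd), iota; split=> //; last first.
  move=> y; rewrite -exJ /= /d; move: (addrAC 0 c 1) => e.
  by case: _ / e.
split=> [n0|n0 /=|E Einj n0 /=]; first exact: Jinj.
  rewrite /d; move: (addrAC n0 c 1) (addrAC (n0 + 1) c 1).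
  move: (n0 + c) (n0 + 1 + c) => a b e; case: b / e => e.
  by case: _ / e => y; apply: Jac.
rewrite /d; move: (addrAC n0 c 1) (addrAC (n0 + 1) c 1).
move: (n0 + c) (n0 + 1 + c) => a b e; case: b / e => e.
by case: _ / e => f; apply: Jhom.
Qed.

Lemma gor_inj_cycles J n : totally_acyclic J -> gor_inj (lker (cdif J n)).
Proof.
by move=> Jta; exists J, n, lker_val; split=> //; [exact: lker_val_inj|exact: lkerP].
Qed.

(** By acyclicity a map from [A] into the cycles takes values in the image of the differential. The
    obstruction to a linear lift lies in Ext^1 of [A] by the cycles one degree lower. *)
Lemma hom_exact_ext1 A J : totally_acyclic J ->
  (forall n, ext1_zero A (lker (cdif J n))) -> hom_exact A J.
Proof.
move=> [_ Jac _] ext n f df.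
apply: ext1_lift (ext n) lker_val_inj (lkerP _) _ => a.
exact: Jac.
Qed.

(** The module [X] is the direct sum of [lker p] and [B], and lifts on the two summands add up. *)
Lemma hom_exact_split X B (p : {linear X -> B}) J :
  inj_module (lker p) -> (forall b, exists x, p x = b) ->
  hom_exact (lker p) J -> hom_exact B J -> hom_exact X J.
Proof.
move=> kinj psurj hk hB n f df.
have [r [s [_ rs]]] := inj_lker_split kinj psurj.
have [g1 g1P] := hk n (f \o lker_val) (fun z => df _).
have [g2 g2P] := hB n (f \o s) (fun b => df _).
exists (mklin (linearP ((g1 \o r) \+ (g2 \o p)))) => x /=.
by rewrite linearD g1P g2P /= -linearD rs.
Qed.
End Complexes.

(** * Injective Gamma-modules *)

Section GammaModules.
Variables (R S : nzRingType) (M : lmodType S) (ra : rightAct R M).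
Implicit Type G : gmod ra.

Fact phi_hom_linear G :
  linear (fun x => HomM (gphi_S x) : Hom ra (gY G)).
Proof. by move=> r x x'; apply: homM_ext => m; rewrite HomPE /= gphi_R. Qed.
Definition phi_hom G : {linear gX G -> Hom ra (gY G)} :=
  mklin (phi_hom_linear (G:=G)).

Lemma phi_hom_eq0 G (x : gX G) :
  phi_hom G x = 0 <-> forall m, gphi G x m = 0.
Proof.
split=> [+ m|x0]; last exact: homM_ext.
by move/(congr1 (fun u : homM M (gY G) => u m)).
Qed.

Lemma phi_epiP G : phi_epi G <-> forall b, exists x, phi_hom G x = b.
Proof.
split=> [epi b|epi h]; last first.
  have [x hx] := epi (Hom_of_lin ra h); exists x => m.
  by have /(congr1 (fun u : homM M (gY G) => u m)) := hx.
have [x hx] := epi (lin_of_Hom b); exists x; exact: homM_ext.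
Qed.

Fact cofree_S (E : lmodType R) (I : lmodType S) (x : E * Hom ra I) s m m' :
  x.2 (s *: m + m') = s *: x.2 m + x.2 m'.
Proof. exact: hlin. Qed.
Fact cofree_R (E : lmodType R) (I : lmodType S) r (x x' : E * Hom ra I) m :
  (r *: x + x').2 m = x.2 (ract ra m r) + x'.2 m.
Proof. by []. Qed.
(* [cofree E I] is the value at [(E, I)] of the right adjoint of the forgetful
   functor sending [(X, Y)_phi] to [(X, Y)]. *)
Definition cofree (E : lmodType R) (I : lmodType S) : gmod ra :=
  GMod (@cofree_S E I) (@cofree_R E I).

Section CofreeMorphism.
Variables (G : gmod ra) (E : lmodType R) (I : lmodType S).
Variables (f : {linear gX G -> E}) (g : {linear gY G -> I}).

Fact cofree_mor_linear :
  linear (fun x => (f x, Hom_post ra g (phi_hom G x)) : E * Hom ra I).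
Proof.
move=> r x x'; apply: injective_projections => /=; first exact: linearP.
by apply: homM_ext => m; rewrite HomPE /= gphi_R linearD.
Qed.
Definition cofree_mor : gmor G (cofree E I) :=
  @GMor _ _ _ _ G (cofree E I) (mklin cofree_mor_linear) g (fun _ _ => erefl).
End CofreeMorphism.

(** A right adjoint of a functor that preserves monomorphisms preserves injectives: extend the two
    components separately, then transpose. *)
Lemma inj_gmod_cofree (E : lmodType R) (I : lmodType S) :
  inj_module E -> inj_module I -> inj_gmod (cofree E I).
Proof.
move=> Einj Iinj A B i iX iY f.
have [h hP] := Iinj _ _ _ iY (mY f).
have l1 : linear (fun x => (mX f x).1) by move=> r u v; rewrite linearP.
have [g gP] := Einj _ _ _ iX (mklin l1).
exists (cofree_mor g h); split=> [a|//].
apply: injective_projections => /=; first exact: gP.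
apply: homM_ext => m /=.
by rewrite -mcomm hP; have := mcomm f a m.
Qed.

Section ExtensionByZero.
Fact gY_only_S (Y : lmodType S) (x : 'rV[R]_0) (s : S) (m m' : M) :
  0 = s *: 0 + 0 :> Y.
Proof. by rewrite scaler0 addr0. Qed.
Fact gY_only_R (Y : lmodType S) (r : R) (x x' : 'rV[R]_0) (m : M) :
  0 = 0 + 0 :> Y.
Proof. by rewrite addr0. Qed.
Definition gY_only (Y : lmodType S) : gmod ra :=
  GMod (@gY_only_S Y) (@gY_only_R Y).

Fact gX_only_S (X : lmodType R) (x : X) (s : S) (m m' : M) :
  0 = s *: 0 + 0 :> 'rV[S]_0.
Proof. by rewrite scaler0 addr0. Qed.
Fact gX_only_R (X : lmodType R) (r : R) (x x' : X) (m : M) :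
  0 = 0 + 0 :> 'rV[S]_0.
Proof. by rewrite addr0. Qed.
Definition gX_only (X : lmodType R) : gmod ra :=
  GMod (@gX_only_S X) (@gX_only_R X).
End ExtensionByZero.

Fact gfree_S (x : R^o) (s : S) (m m' : M) :
  ract ra (s *: m + m') x = s *: ract ra m x + ract ra m' x.
Proof. by rewrite ract_addl ract_scale. Qed.
Fact gfree_R (r : R) (x x' : R^o) (m : M) :
  ract ra m (r *: x + x') = ract ra (ract ra m r) x + ract ra m x'.
Proof. by rewrite ract_addr ract_mul. Qed.
(* The projective Gamma-module (R, M). *)
Definition gfree : gmod ra := GMod gfree_S gfree_R.

Definition gY_only_mor (Y : lmodType S) G (f : {linear Y -> gY G}) :
  gmor (gY_only Y) G.
Proof.
apply: (@GMor _ _ _ _ (gY_only Y) G (mklin (@zero_linear _ _ _)) f) => x m /=.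
by rewrite linear0; have /phi_hom_eq0 -> := linear0 (phi_hom G).
Defined.

Definition gX_only_mor (X : lmodType R) G (f : {linear X -> gX G})
  (phif : forall x, phi_hom G (f x) = 0) : gmor (gX_only X) G.
Proof.
apply: (@GMor _ _ _ _ (gX_only X) G f (mklin (@zero_linear _ _ _))) => x m /=.
by have /phi_hom_eq0 -> := phif x.
Defined.

(** Each property results from extending morphisms along one kind of inclusion: (0, A) in (0, B),
    (A, 0) in (B, 0), and (0, M) in (R, M). *)
Lemma inj_gmodP G : inj_gmod G ->
  [/\ inj_module (gY G), inj_module (lker (phi_hom G)) &
      forall b, exists x, phi_hom G x = b].
Proof.
move=> Ginj; split.
- move=> A B i i_inj f.
  have [||g [_ gP]] := Ginj _ _ (gY_only_mor (G:=gY_only B) i) _ _ (gY_only_mor f).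
  + by move=> x y _; rewrite [x]thinmx0 [y]thinmx0.
  + exact: i_inj.
  + by exists (mY g).
- move=> A B i i_inj f.
  have pi (x : A) : phi_hom (gX_only B) (i x) = 0 by apply/phi_hom_eq0.
  have [||g [gP _]] := Ginj _ _ (gX_only_mor pi) _ _
      (gX_only_mor (f := lker_val \o f) (fun x => lker_valE (f x))).
  + exact: i_inj.
  + by move=> x y _; rewrite [x]thinmx0 [y]thinmx0.
  have pg b : phi_hom G (mX g b) = 0.
    by apply/phi_hom_eq0 => m; rewrite -mcomm /= linear0.
  by exists (lker_lift pg) => a; apply: lker_val_inj; rewrite lker_liftK gP.
(* View [h] as a morphism (0, M) -> G; an extension to (R, M) sends 1 to a preimage of [h] under
   phi. *)
- apply/phi_epiP => h.
  have [||g [_ gP]] := Ginj _ _ (gY_only_mor (G:=gfree) (mklin (linearP idfun))) _ _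
     (gY_only_mor h).
  + by move=> x y _; rewrite [x]thinmx0 [y]thinmx0.
  + by [].
  exists (mX g 1) => m; rewrite -mcomm -gP /=; congr (mY g _); exact: ract1.
Qed.
End GammaModules.

(** * The complexes of kernels of phi and of Y-components *)

Section Components.
Variables (R S : nzRingType) (M : lmodType S) (ra : rightAct R M).
Implicit Types (J : gcpx ra) (JY : cpx S) (JK : cpx R).


Lemma phi_hom_mor (A B : gmod ra) (f : gmor A B) x :
  phi_hom B (mX f x) = Hom_post ra (mY f) (phi_hom A x).
Proof. by apply: homM_ext => m; apply: esym; apply: mcomm. Qed.

Lemma phi_hom_cofree E I (x : gX (cofree ra E I)) :
  phi_hom (cofree ra E I) x = x.2.
Proof. exact: homM_ext. Qed.

Definition Hom_acyclic JY := forall n (b : Hom ra (cobj JY (n + 1))),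
  Hom_post ra (cdif JY (n + 1)) b = 0 ->
  exists b', Hom_post ra (cdif JY n) b' = b.

Lemma hom_M_acyclicP JY : hom_M_acyclic M JY -> Hom_acyclic JY.
Proof.
move=> h n b db; have [m|b' b'P] := h n (lin_of_Hom b).
  by have := congr1 (fun u : homM M _ => u m) db.
by exists (Hom_of_lin ra b'); apply: homM_ext => m; apply: b'P.
Qed.

Definition Y_cpx J : cpx S :=
  @Cpx S (fun n => gY (gobj J n)) (fun n => mY (gdif J n)) (@gddY _ _ _ _ J).

Section KernelComplex.
Variable J : gcpx ra.

Fact ker_dif_subproof n (z : lker (phi_hom (gobj J n))) :
  phi_hom _ ((mX (gdif J n) \o lker_val) z) = 0.
Proof. by rewrite [LHS]phi_hom_mor lker_valE linear0. Qed.
Definition ker_dif n := lker_lift (@ker_dif_subproof n).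
Fact ker_dd n z : ker_dif (n + 1) (ker_dif n z) = 0.
Proof. by apply: lker_val_inj; rewrite !lker_liftK /= gddX. Qed.
Definition ker_cpx : cpx R := Cpx ker_dd.

(** In the exact sequence 0 -> K -> X -> Hom(M, Y) -> 0 of complexes the last two are acyclic, hence
    so is the first. Concretely, a preimage [x] in X of a cycle is corrected by the differential of
    some [x'] so that phi of the difference vanishes. *)
Lemma ker_cpx_acyclic : gacyclic J ->
  (forall n b, exists x, phi_hom (gobj J n) x = b) -> Hom_acyclic (Y_cpx J) ->
  acyclic ker_cpx.
Proof.
move=> Jac surj Yac n.
(* The correcting element [x'] lives one degree below [n]. *)
have [m ->] : exists m, n = m + 1 by exists (n - 1); rewrite subrK.
move=> y /(congr1 lker_val) dy.
have [x dx] := (Jac (m + 1)).1 _ dy.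
have /Yac[b bP] : Hom_post ra (mY (gdif J (m + 1))) (phi_hom _ x) = 0.
  by rewrite -phi_hom_mor dx lker_valE.
have [x' x'P] := surj m b.
have /lkerP[z zP] : phi_hom _ (x - mX (gdif J m) x') = 0.
  by rewrite linearB phi_hom_mor x'P [X in _ - X]bP subrr.
exists z; apply: lker_val_inj.
transitivity (mX (gdif J (m + 1)) (lker_val z)) => //.
by rewrite zP linearB gddX subr0.
Qed.

Lemma ker_cpx_totally_acyclic :
  gtotally_acyclic J -> Hom_acyclic (Y_cpx J) -> totally_acyclic ker_cpx.
Proof.
move=> [Jinj Jac Jhom] Yac; split.
- by move=> n; have [] := inj_gmodP (Jinj n).
- by apply: ker_cpx_acyclic => // n; have [] := inj_gmodP (Jinj n).
move=> E Einj n f df.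
(* The triple (E, 0) is taken as [cofree E 0], whose injectivity is already known. *)
have EJ := Jhom _ (inj_gmod_cofree (ra := ra) Einj (@inj_module0 S)).
pose E0 := cofree ra E 'rV[S]_0.
have fl : linear (fun u : gX E0 => lker_val (f u.1)) by move=> r u v; rewrite !linearP.
have fc (u : gX E0) m : mklin (@zero_linear S _ (gY (gobj J (n + 1)))) (gphi E0 u m)
    = gphi (gobj J (n + 1)) (mklin fl u) m.
  by have /phi_hom_eq0 -> := lker_valE (f u.1).
have [||g [gP _]] := EJ n (GMor fc).
- by move=> u; apply: (congr1 lker_val (df u.1)).
- by move=> y /=; rewrite linear0.
have hl : linear (fun e => mX g (e, 0)).
  move=> r u v; rewrite -linearP; congr (mX g _).
  by apply: injective_projections => //=; rewrite scaler0 addr0.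
have ph e : phi_hom _ (mklin hl e) = 0.
  by rewrite [LHS]phi_hom_mor phi_hom_cofree linear0.
by exists (lker_lift ph) => e; apply: lker_val_inj; apply: gP.
Qed.

Lemma Y_cpx_totally_acyclic : gtotally_acyclic J -> Hom_acyclic (Y_cpx J) ->
  (forall I, inj_module I -> hom_exact (Hom ra I) ker_cpx) ->
  totally_acyclic (Y_cpx J).
Proof.
move=> [Jinj Jac Jhom] Yac homK; split.
- by move=> n; have [] := inj_gmodP (Jinj n).
- by move=> n; exact: (Jac n).2.
move=> I Iinj n f df.
have IJ := Jhom _ (inj_gmod_cofree (ra := ra) (@inj_module0 R) Iinj).
pose F0 := cofree ra 'rV[R]_0 I.
have [_ Kinj surj] := inj_gmodP (Jinj (n + 1)).
(* Composing [s] with [Hom_post ra f] lifts [f] through phi, but the result need not be a cycle. Its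
   differential is a cycle in the kernel complex, hence the differential of some [g], and
   subtracting [g] repairs the lift. *)
have [_ [s [sP _]]] := inj_lker_split Kinj surj.
have cK a : phi_hom _ ((mX (gdif J (n + 1)) \o (s \o Hom_post ra f)) a) = 0.
  by rewrite [LHS]phi_hom_mor sP; apply: homM_ext => m; apply: df.
have [|g gP] := homK I Iinj (n + 1) (lker_lift cK).
  by move=> a; apply: lker_val_inj; rewrite !lker_liftK /= gddX.
have Fl : linear (fun u : gX F0 => s (Hom_post ra f u.2) - lker_val (g u.2)).
  pose q : {linear gX F0 -> Hom ra I} := snd.
  exact: (linearP ((s \o (Hom_post ra f \o q)) \- (lker_val \o (g \o q)))).
have Fphi u : phi_hom _ (mklin Fl u) = Hom_post ra f u.2.
  by rewrite [LHS]linearB lker_valE subr0 sP.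
have Fc (u : gX F0) m : f (gphi F0 u m) = gphi (gobj J (n + 1)) (mklin Fl u) m.
  exact: (esym (congr1 (fun w : homM M _ => w m) (Fphi u))).
have [x|//|h [_ hP]] := IJ n (GMor Fc); last by exists (mY h).
have := congr1 lker_val (gP x.2); rewrite !lker_liftK /= => gx.
by rewrite linearB gx subrr.
Qed.
End KernelComplex.

(** * Gluing two complexes along theta *)

Section Twist.
Variables (JK : cpx R) (JY : cpx S).

(** The invariant that cycles go to cycles, carried in [T], drives both recursions. To the right it
    makes the next map well defined on boundaries, which are all the cycles; to the left it makes
    [th] after the differential land in cycles, so that it lifts. *)
Lemma twist_exists
    (theta0 : {linear Hom ra (cobj JY 0) -> cobj JK (0 + 1)}) :
  (forall n, inj_module (cobj JK n)) -> Hom_acyclic JY ->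
  (forall n, hom_exact (Hom ra (cobj JY n)) JK) ->
  (forall a, Hom_post ra (cdif JY 0) a = 0 -> cdif JK (0 + 1) (theta0 a) = 0) ->
  exists theta : forall n, {linear Hom ra (cobj JY n) -> cobj JK (n + 1)},
    theta 0 = theta0 /\
    forall n a, cdif JK (n + 1) (theta n a) +
                theta (n + 1) (Hom_post ra (cdif JY n) a) = 0.
Proof.
move=> Kinj Yac homK theta0P.
pose T n := {th : {linear Hom ra (cobj JY n) -> cobj JK (n + 1)} |
  forall a, Hom_post ra (cdif JY n) a = 0 -> cdif JK (n + 1) (th a) = 0}.
pose P n (t : T n) (t' : T (n + 1)) :=
  forall a, cdif JK (n + 1) (sval t a) + sval t' (Hom_post ra (cdif JY n) a) = 0.
have dd n a : Hom_post ra (cdif JY (n + 1)) (Hom_post ra (cdif JY n) a) = 0.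
  by apply: homM_ext => m; apply: cdd.
have [||t [t0 tP]] := @int_two_sided_choice T P (exist _ theta0 theta0P).
- move=> n [th thP].
  have [|h hP] := inj_extend (g := mklin (linearP (\- (cdif JK (n + 1) \o th))))
      (Kinj _) (@dd n) (Yac n).
    by move=> a /thP /= ->; rewrite oppr0.
  have good a : Hom_post ra (cdif JY (n + 1)) a = 0 ->
      cdif JK (n + 1 + 1) (h a) = 0.
    by move=> /Yac[a' <-]; rewrite hP /= linearN cdd oppr0.
  by exists (exist _ h good) => a /=; rewrite hP /= subrr.
- move=> n [th thP].
  have [a|g gP] := homK n (n + 1) (th \o Hom_post ra (cdif JY n)).
    exact/thP/dd.
  have good a : Hom_post ra (cdif JY n) a = 0 ->
      cdif JK (n + 1) (mklin (linearP (\- g)) a) = 0.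
    by move=> a0; rewrite /= linearN gP -[X in - X]/(th (Hom_post ra (cdif JY n) a)) a0 linear0 oppr0.
  by exists (exist _ (mklin (linearP (\- g))) good) => a /=; rewrite linearN gP addNr.
by exists (fun n => sval (t n)); split=> [|n a]; [rewrite t0 | apply: tP].
Qed.

Variable theta : forall n, {linear Hom ra (cobj JY n) -> cobj JK (n + 1)}.
Hypothesis thetaP : forall n a, cdif JK (n + 1) (theta n a) +
  theta (n + 1) (Hom_post ra (cdif JY n) a) = 0.

Definition twist_obj n := cofree ra (cobj JK n) (cobj JY n).
Fact twist_dif_linear n :
  linear (fun u : gX (twist_obj n) => cdif JK n u.1 + theta n u.2).
Proof. exact: (linearP ((cdif JK n \o fst) \+ (theta n \o snd))). Qed.
(** On the X-components this yields, up to shift, the mapping cone of [theta], seen as a chain map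
    from Hom(M, [JY]) to the suspension of [JK], whose differential carries a sign. *)
Definition twist_dif n : gmor (twist_obj n) (twist_obj (n + 1)) :=
  cofree_mor (mklin (@twist_dif_linear n)) (cdif JY n).

Lemma twist_difE n u :
  mX (twist_dif n) u = (cdif JK n u.1 + theta n u.2, Hom_post ra (cdif JY n) u.2).
Proof. by apply: injective_projections => //; apply: homM_ext. Qed.

Fact twist_ddX n u : mX (twist_dif (n + 1)) (mX (twist_dif n) u) = 0.
Proof.
rewrite !twist_difE; apply: injective_projections => /=.
  by rewrite linearD cdd add0r thetaP.
by apply: homM_ext => m; apply: cdd.
Qed.
Fact twist_ddY n y : mY (twist_dif (n + 1)) (mY (twist_dif n) y) = 0.
Proof. exact: cdd. Qed.
Definition twist_cpx : gcpx ra := GCpx twist_ddX twist_ddY.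

(** The differential is triangular, so equations are solved first in the [JY] part; after
    subtracting the contribution of [theta], what remains is an equation in [JK]. *)
Lemma twist_totally_acyclic : totally_acyclic JK -> totally_acyclic JY ->
  Hom_acyclic JY -> (forall I, inj_module I -> hom_exact (Hom ra I) JK) ->
  gtotally_acyclic twist_cpx.
Proof.
move=> [Kinj Kac Khom] [Yinj Yac Yhom] HYac homK; split.
- by move=> n; apply: inj_gmod_cofree.
- move=> n; split; last exact: Yac.
  case=> k a; rewrite [LHS]twist_difE => dka.
  have dk : cdif JK (n + 1) k + theta (n + 1) a = 0 := congr1 fst dka.
  have [b bP] := HYac n a (congr1 snd dka).
  have [|k' k'P] := Kac n (k - theta n b).
    rewrite linearB; apply/eqP; rewrite subr_eq0; apply/eqP.
    have := thetaP b; rewrite bP => /eqP; rewrite addr_eq0 => /eqP ->.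
    by apply/eqP; rewrite -addr_eq0 dk.
  exists (k', b); rewrite [LHS]twist_difE; apply: injective_projections => //.
  by rewrite /= k'P subrK.
move=> E Einj n f dfX dfY; have [EY EK Esurj] := inj_gmodP Einj.
have [g2 g2P] := Yhom _ EY n (mY f) dfY.
(* As an R-module, [gX E] is the sum of the injective module ker phi and Hom(M, [gY E]), so each
   summand can be treated alone. *)
have homX : hom_exact (gX E) JK.
  by apply: hom_exact_split Esurj _ _ => //; [exact: Khom | exact: homK].
have f2 x : (mX f x).2 = Hom_post ra (cdif JY n) (Hom_post ra g2 (phi_hom E x)).
  by rewrite -phi_hom_cofree phi_hom_mor; apply: homM_ext => m /=; rewrite g2P.
have fl : linear (fun x => (mX f x).1 - theta n (Hom_post ra g2 (phi_hom E x))).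
  pose p : {linear gX (twist_obj (n + 1)) -> cobj JK (n + 1)} := fst.
  exact: (linearP ((p \o mX f) \- (theta n \o (Hom_post ra g2 \o phi_hom E)))).
have [x|g1 g1P] := homX n (mklin fl).
  pose b := Hom_post ra g2 (phi_hom E x).
  have dx : cdif JK (n + 1) (mX f x).1 + theta (n + 1) (Hom_post ra (cdif JY n) b) = 0.
    by rewrite -f2; apply: (congr1 fst (etrans (esym (twist_difE _)) (dfX x))).
  rewrite linearB; apply/eqP; rewrite subr_eq0 -/b; apply/eqP.
  apply: (addIr (theta (n + 1) (Hom_post ra (cdif JY n) b))).
  by rewrite dx thetaP.
exists (cofree_mor g1 g2); split=> // x.
rewrite [LHS]twist_difE; apply: injective_projections; last by rewrite f2.
by rewrite /= g1P subrK.
Qed.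
End Twist.
End Components.

(** * Left exactness of Hom_S(M, -) *)

Lemma Hom_post_inj (R S : nzRingType) (M : lmodType S) (ra : rightAct R M)
    (I I' : lmodType S) (f : {linear I -> I'}) :
  injective f -> injective (Hom_post ra f).
Proof.
move=> f_inj u v uv; apply: homM_ext => m; apply: f_inj.
exact: (congr1 (fun w : homM M I' => w m) uv).
Qed.

(** Pointwise preimages under [f] are unique because [f] is injective, so they form a linear map. *)
Lemma Hom_post_exact (R S : nzRingType) (M : lmodType S) (ra : rightAct R M)
    (I I' I'' : lmodType S) (f : {linear I -> I'}) (g : {linear I' -> I''}) :
  injective f -> (forall y, g y = 0 <-> exists x, f x = y) ->
  forall b, Hom_post ra g b = 0 <-> exists a, Hom_post ra f a = b.
Proof.
move=> f_inj exf b; split=> [gb|[a <-]]; last first.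
  by apply: homM_ext => m; apply/exf; exists (a m).
have [m|x|s m m' x x' hx hx'|h hP] := @linear_choice _ _ _ (fun m x => f x = b m).
- by apply/exf; apply: (congr1 (fun w : homM M I'' => w m) gb).
- by rewrite [b 0](linear0 (lin_of_Hom b)) -(linear0 f) => /f_inj.
- by rewrite linearP hx hx' hlin.
by exists (Hom_of_lin ra h); apply: homM_ext => m; apply: hP.
Qed.

(** * The two directions of the characterization *)

Section Characterization.
Variables (R S : nzRingType) (M : lmodType S) (ra : rightAct R M).
Hypothesis H3 : forall J : cpx S, acyclic J ->
  (forall n, inj_module (cobj J n)) -> hom_M_acyclic M J.
Hypothesis H4 : forall I : lmodType S, inj_module I ->
  forall (A : lmodType R) (al : A -> M -> I), hom_pres ra al ->
  forall H : lmodType R, gor_inj H -> ext1_zero A H.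

(** The cycles of [J] are Gorenstein injective, so [H4] gives the vanishing of Ext^1 that lifting
    requires. *)
Lemma hom_exact_Hom (I : lmodType S) (J : cpx R) :
  inj_module I -> totally_acyclic J -> hom_exact (Hom ra I) J.
Proof.
move=> Iinj Jta; apply: hom_exact_ext1 => // n.
by apply: (H4 Iinj (Hom_hom_pres ra I)); apply: gor_inj_cycles.
Qed.

Lemma gor_inj_gmod_components (G : gmod ra) :
  gor_inj_gmod G -> (gor_inj (gY G) /\ ker_phi_gor_inj G) /\ phi_epi G.
Proof.
case=> J [n [iota [Jta iX iY exX exY]]]; have [Jinj Jac _] := Jta.
have Yac : Hom_acyclic ra (Y_cpx J).
  apply/hom_M_acyclicP/H3 => m; first exact: (Jac m).2.
  by have [] := inj_gmodP (Jinj m).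
have Kta := ker_cpx_totally_acyclic Jta Yac.
have Yta : totally_acyclic (Y_cpx J).
  by apply: Y_cpx_totally_acyclic => // I Iinj; apply: hom_exact_Hom.
have iotaH := Hom_post_inj (ra := ra) iY.
split; first split.
- by exists (Y_cpx J), n, (mY iota).
- exists (lker (phi_hom G)), lker_val; split; last 2 first.
  + exact: lker_val_inj.
  + by move=> x; rewrite -phi_hom_eq0; apply: lkerP.
  have pi (z : lker (phi_hom G)) : phi_hom _ ((mX iota \o lker_val) z) = 0.
    by rewrite [LHS]phi_hom_mor lker_valE linear0.
  exists (ker_cpx J), n, (lker_lift pi); split=> //.
    by move=> z z' /(congr1 lker_val) /iX /lker_val_inj.
  move=> y; split=> [/(congr1 lker_val) /exX[x xy]|[z <-]].
    have /lkerP[z zx] : phi_hom G x = 0.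
      by apply: iotaH; rewrite -phi_hom_mor xy lker_valE linear0.
    by exists z; apply: lker_val_inj; rewrite lker_liftK -xy -zx.
  by apply: lker_val_inj; apply/exX; exists (lker_val z).
(* Lift the image of [b] in Hom(M, Y_n) to [x]. The differential of [x] is a cycle in the kernel
   complex, hence the differential of some [w] there, and [x - w] comes from [G]. *)
- apply/phi_epiP => b.
  have [_ _ surj] := inj_gmodP (Jinj n).
  have [x xb] := surj (Hom_post ra (mY iota) b).
  have /lkerP[z zx] : phi_hom _ (mX (gdif J n) x) = 0.
    by rewrite phi_hom_mor xb; apply/(Hom_post_exact iY exY); exists b.
  have [_ Kac _] := Kta.
  have [|w wz] := Kac n z.
    by apply: lker_val_inj; rewrite [RHS]linear0 -(gddX (g:=J) x) -zx.
  have /exX[g gx] : mX (gdif J n) (x - lker_val w) = 0.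
    by rewrite linearB -zx -wz subrr.
  exists g; apply: iotaH.
  by rewrite -phi_hom_mor gx linearB lker_valE subr0.
Qed.

Lemma gor_inj_gmod_of_components (G : gmod ra) :
  gor_inj (gY G) -> ker_phi_gor_inj G -> phi_epi G -> gor_inj_gmod G.
Proof.
move=> /gor_inj_at0[JY [iY [Yta iY_inj exY]]].
move=> [K [k [/gor_inj_at0[JK [iK [Kta iK_inj exK]]] k_inj exk]]] /phi_epiP epi.
have [Kinj _ _] := Kta; have [Yinj Yac _] := Yta.
have HYac : Hom_acyclic ra JY by apply/hom_M_acyclicP/H3.
have homK I : inj_module I -> hom_exact (Hom ra I) JK.
  by move=> Iinj; apply: hom_exact_Hom.
have exY' := Hom_post_exact (ra := ra) iY_inj exY.
have {}exk x : phi_hom G x = 0 <-> exists z, k z = x.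
  by rewrite phi_hom_eq0.
(* The map [alpha] extends the embedding of ker phi to all of [gX G]; together with [iY] it will
   embed [G] in degree 0 of the twisted complex. *)
have [alpha alphaP] := Kinj 0 _ _ _ k_inj iK.
(* [theta0] is forced on the cycles [Hom (M, Y)] of [Hom (M, JY)] by the
   requirement that [(alpha, iY phi)] lands in the kernel of the differential. *)
have [||a|theta0 theta0P] := inj_extend (f := Hom_post ra iY \o phi_hom G)
    (c := Hom_post ra (cdif JY 0)) (g := mklin (linearP (\- (cdif JK 0 \o alpha))))
    (Kinj (0 + 1)).
- by move=> x; apply/exY'; exists (phi_hom G x).
- by move=> b /exY'[c <-]; have [x <-] := epi c; exists x.
- rewrite /comp -(linear0 (Hom_post ra iY)) => /(Hom_post_inj iY_inj) /exk[z <-].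
  by rewrite /= alphaP; apply/eqP; rewrite oppr_eq0; apply/eqP/exK; exists z.
have [|theta [th0 thetaP]] := @twist_exists _ _ _ _ _ _ theta0 Kinj HYac
    (fun n => homK _ (Yinj n)).
  move=> a /exY'[c <-]; have [x <-] := epi c.
  by rewrite [theta0 _]theta0P /= linearN cdd oppr0.
have Jta := twist_totally_acyclic thetaP Kta Yta HYac homK.
exists (twist_cpx thetaP), 0, (cofree_mor alpha iY); split=> //.
- move=> x x' /eqP; rewrite -subr_eq0 -linearB => /eqP xx'.
  apply/eqP; rewrite -subr_eq0; apply/eqP.
  have px : phi_hom G (x - x') = 0.
    by apply: (Hom_post_inj iY_inj); rewrite linear0; apply: (congr1 snd xx').
  have /exk[z zx] := px.
  have : alpha (x - x') = 0 by apply: (congr1 fst xx').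
  by rewrite -zx alphaP -(linear0 iK) => /iK_inj ->; rewrite linear0.
- case=> u a; split=> [du|[x <-]]; last first.
    rewrite [LHS]twist_difE; apply: injective_projections; last first.
      by apply/exY'; exists (phi_hom G x).
    by rewrite /= th0 [theta0 _]theta0P addrN.
  have {}du := etrans (esym (twist_difE _ _)) du.
  have du1 : cdif JK 0 u + theta 0 a = 0 := congr1 fst du.
  have du2 : Hom_post ra (cdif JY 0) a = 0 := congr1 snd du.
  (* Choose [x] whose phi accounts for [a]. By the choice of [theta0], [u - alpha x] is then a
     cycle, so it comes from some [z] in ker phi, and [x + k z] is the preimage. *)
  have /exY'[c ca] := du2; have [x xc] := epi c.
  have /exK[z zP] : cdif JK 0 (u - alpha x) = 0.
    by rewrite linearB -du1 th0 -ca -xc [theta0 _]theta0P.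
  exists (x + k z); apply: injective_projections.
    by rewrite /= linearD alphaP zP addrC subrK.
  have kz : phi_hom G (k z) = 0 by apply/exk; exists z.
  transitivity (Hom_post ra iY (phi_hom G (x + k z))) => //.
  by rewrite linearD kz addr0 xc ca.
Qed.
End Characterization.

Theorem theorem2p8 (R S : nzRingType) (M : lmodType S) (ra : rightAct R M)
  (H3 : forall J : cpx S, acyclic J -> (forall n, inj_module (cobj J n)) ->
          hom_M_acyclic M J)
  (H4 : forall I : lmodType S, inj_module I ->
          forall (A : lmodType R) (al : A -> M -> I), hom_pres ra al ->
          forall H : lmodType R, gor_inj H -> ext1_zero A H)
  (G : gmod ra) :
  gor_inj_gmod G <-> ((gor_inj (gY G) /\ ker_phi_gor_inj G) /\ phi_epi G).
Proof.
split; first exact: gor_inj_gmod_components.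
by case=> -[hY hK] epi; apply: gor_inj_gmod_of_components.
Qed.
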